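(* Let $(E,+,{}',0,1)$ be a lattice effect algebra with induced order $\leq$ and join $\vee$, and define the natural implication $x\rightarrow y:=y+(x\vee y)'$ for all $x,y\in E$. Then for all $a,b,c\in E$: (i) $a\leq b$ if and only if $a\rightarrow b=1$; (ii) if $a\leq b'$ then $a+b=a'\rightarrow b$; (iii) if $a\geq b$ then $a\rightarrow b=a'+b$; (iv) if $a\geq b$ then $a\rightarrow b=b'\rightarrow a'$; (v) if $a\leq b$ then $b\rightarrow c\leq a\rightarrow c$.
   Context: An effect algebra is a structure $(E,+,{}',0,1)$ where $E$ is a set, ${}'$ is a unary operation on $E$, $0,1\in E$, and $+$ is a partial binary operation on $E$ such that for all $x,y,z\in E$: (E1) if $x+y$ is defined then so is $y+x$ and $x+y=y+x$; (E2) $(x+y)+z$ is defined if and only if $x+(y+z)$ is defined, and then they are equal; (E3) $x+y$ is defined and equals $1$ if and only if $y=x'$; (E4) if $1+x$ is defined then $x=0$. The induced order is defined by $x\leq y$ iff there exists $z\in E$ with $x+z=y$; it is a partial order with least element $0$ and greatest element $1$. The effect algebra is a lattice effect algebra if $(E,\leq)$ is a lattice; $\vee$ and $\wedge$ denote its join and meet. *)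

(* Defs.v *)
From mathcomp Require Import all_boot.

Set Implicit Arguments.
Unset Strict Implicit.
Unset Printing Implicit Defensive.

(* The partial addition is option-valued: [x + y] is defined with value [s]
   when [oplus x y = Some s].  In (E2), [obind] makes each side defined exactly
   when both of its additions are. *)
Record effectAlgebra := EffectAlgebra {
  ea_sort :> Type;
  oplus : ea_sort -> ea_sort -> option ea_sort;
  compl : ea_sort -> ea_sort;
  zero : ea_sort;
  one : ea_sort;
  oplusC : forall x y s, oplus x y = Some s -> oplus y x = Some s;
  oplusA : forall x y z,
    obind (fun s => oplus s z) (oplus x y) =
    obind (fun t => oplus x t) (oplus y z);
  oplus_eq1 : forall x y, oplus x y = Some one <-> y = compl x;
  oplus1x : forall x, isSome (oplus one x) -> x = zero
}.

Arguments oplus {e} x y.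
Arguments compl {e} x.
Arguments zero {e}.
Arguments one {e}.

Definition ea_le (E : effectAlgebra) (x y : E) : Prop :=
  exists z, oplus x z = Some y.

Definition is_sup (E : effectAlgebra) (x y s : E) : Prop :=
  [/\ ea_le x s, ea_le y s &
      forall u, ea_le x u -> ea_le y u -> ea_le s u].

Definition is_inf (E : effectAlgebra) (x y i : E) : Prop :=
  [/\ ea_le i x, ea_le i y &
      forall u, ea_le u x -> ea_le u y -> ea_le u i].

(* [join] and [meet] are determined by the effect algebra, since [ea_le] is
   antisymmetric ([ea_le_anti] below). *)
Record latticeEffectAlgebra := LatticeEffectAlgebra {
  lea_ea :> effectAlgebra;
  join : lea_ea -> lea_ea -> lea_ea;
  meet : lea_ea -> lea_ea -> lea_ea;
  joinP : forall x y, is_sup x y (join x y);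
  meetP : forall x y, is_inf x y (meet x y)
}.

Arguments join {l} x y.
Arguments meet {l} x y.

Section Basics.
Variable E : effectAlgebra.
Implicit Types x y z s : E.

Lemma oplus_compl x : oplus x (compl x) = Some one.
Proof. exact/oplus_eq1. Qed.

Lemma complK x : compl (compl x) = x.
Proof. by symmetry; apply/oplus_eq1; apply: oplusC; apply: oplus_compl. Qed.

Lemma compl1 : compl one = zero :> E.
Proof. by apply: oplus1x; rewrite oplus_compl. Qed.

Lemma oplusx0 x : oplus x zero = Some x.
Proof.
have := oplusA (compl x) x zero.
rewrite (oplusC (oplus_compl x)) /= -compl1 oplus_compl.
case: (oplus x (compl one)) => [t|] //= h.
by rewrite (proj1 (oplus_eq1 _ _) (esym h)) complK.
Qed.

Lemma ea_le_refl x : ea_le x x.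
Proof. by exists zero; apply: oplusx0. Qed.

Lemma ea_le_trans x y z : ea_le x y -> ea_le y z -> ea_le x z.
Proof.
move=> [u hu] [v hv]; have := oplusA x u v; rewrite hu /= hv.
by case: (oplus u v) => [t|] //= ht; exists t.
Qed.

Lemma ea_le_anti x y : ea_le x y -> ea_le y x -> x = y.
Proof.
move=> [u hu] [v hv].
have := oplusA (compl x) x u.
rewrite hu (oplusC (oplus_compl x)) /= => h1.
have := oplusA (compl x) y v; rewrite hv /= (oplusC (oplus_compl x)) -h1.
case hu1: (oplus one u) => [t|] //= _.
have u0 : u = zero by apply: oplus1x; rewrite hu1.
by move: hu; rewrite u0 oplusx0 => -[].
Qed.

Lemma ea_le0x x : ea_le zero x.
Proof. by exists x; apply: oplusC; apply: oplusx0. Qed.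

Lemma ea_lex1 x : ea_le x one.
Proof. by exists (compl x); apply: oplus_compl. Qed.

Lemma oplus_compl_ge x y : ea_le x y -> isSome (oplus x (compl y)).
Proof.
move=> [z /oplusC hz]; have := oplusA z x (compl y).
by rewrite hz /= oplus_compl; case: (oplus x (compl y)).
Qed.

End Basics.

Definition oget T (o : option T) : isSome o -> T :=
  if o is Some s as o0 return isSome o0 -> T then fun=> s
  else fun h => False_rect T (notF h).

Lemma ogetE T (o : option T) (h : isSome o) : o = Some (oget h).
Proof. by case: o h. Qed.

Section NatImp.
Variable E : latticeEffectAlgebra.
Implicit Types x y : E.

Lemma natimp_defined x y : isSome (oplus y (compl (join x y))).
Proof. by apply: oplus_compl_ge; case: (joinP x y). Qed.

Definition natimp x y : E := oget (natimp_defined x y).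

Lemma natimpE x y : oplus y (compl (join x y)) = Some (natimp x y).
Proof. exact: ogetE. Qed.

End NatImp.

(* Main.v *)
Require Import Defs.
From mathcomp Require Import ssreflect ssrfun ssrbool.

Set Implicit Arguments.
Unset Strict Implicit.
Unset Printing Implicit Defensive.

(** On comparable elements the join is the larger one, so the implication collapses: it is
    [y + y' = 1] when [x <= y], and [y + x'] when [y <= x] ([natimp_ge]). The former gives half of
    (i); the other half holds because (E3) makes complements unique. Parts (ii) and (iv) are (iii)
    read through the complement, an order-reversing involution ([compl_le], [complK]). Part (v)
    composes the monotone join, the antitone complement and the monotone sum ([oplus_le2l]). *)

(** If [x + z = y], then [1 = (x + z) + y' = x + (z + y')], so (E3) forces [z + y' = x']: the same
    difference [z] serves as witness. *)
Lemma compl_le (E : effectAlgebra) (x y : E) :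
  ea_le x y -> ea_le (compl y) (compl x).
Proof.
move=> [z hz]; have := oplusA x z (compl y).
rewrite hz /= oplus_compl; case hzy: (oplus z (compl y)) => [t|] //= ht.
exists z; apply: oplusC; rewrite hzy; congr Some.
exact: (proj1 (oplus_eq1 _ _) (esym ht)).
Qed.

Lemma oplus_le2l (E : effectAlgebra) (c x y s t : E) :
  ea_le x y -> oplus c x = Some t -> oplus c y = Some s -> ea_le t s.
Proof.
by move=> [z hz] ht hs; exists z; have := oplusA c x z; rewrite ht hz /= hs.
Qed.

Lemma join_l (E : latticeEffectAlgebra) (x y : E) :
  ea_le y x -> join x y = x.
Proof.
case: (joinP x y) => hx _ hmin yx.
by apply: ea_le_anti hx; apply: hmin => //; apply: ea_le_refl.
Qed.

Lemma join_r (E : latticeEffectAlgebra) (x y : E) :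
  ea_le x y -> join x y = y.
Proof.
case: (joinP x y) => _ hy hmin xy.
by apply: ea_le_anti hy; apply: hmin => //; apply: ea_le_refl.
Qed.

Lemma join_le2r (E : latticeEffectAlgebra) (c x y : E) :
  ea_le x y -> ea_le (join x c) (join y c).
Proof.
case: (joinP x c) (joinP y c) => _ _ hmin [hy hc _] xy.
by apply: hmin hc; apply: ea_le_trans hy.
Qed.

Lemma natimp_eq1 (E : latticeEffectAlgebra) (x y : E) :
  ea_le x y <-> natimp x y = one.
Proof.
split=> [xy|h1].
  by have := natimpE x y; rewrite (join_r xy) oplus_compl => -[].
(* By (E3), [(join x y)' = y']; complementing again gives [join x y = y], which lies above [x]. *)
have /oplus_eq1 hj : oplus y (compl (join x y)) = Some one by rewrite natimpE h1.
by case: (joinP x y) => hx _ _; rewrite -[y]complK -hj complK.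
Qed.

Lemma natimp_ge (E : latticeEffectAlgebra) (x y : E) :
  ea_le y x -> oplus (compl x) y = Some (natimp x y).
Proof. by move=> yx; apply: oplusC; rewrite -natimpE join_l. Qed.

Lemma natimp_antil (E : latticeEffectAlgebra) (x y z : E) :
  ea_le x y -> ea_le (natimp y z) (natimp x z).
Proof.
move=> xy; apply: oplus_le2l (natimpE y z) (natimpE x z).
exact/compl_le/join_le2r.
Qed.

Theorem theorem2p1 (E : latticeEffectAlgebra) (a b c : E) :
  (ea_le a b <-> natimp a b = one) /\
  (ea_le a (compl b) -> oplus a b = Some (natimp (compl a) b)) /\
  (ea_le b a -> oplus (compl a) b = Some (natimp a b)) /\
  (ea_le b a -> natimp a b = natimp (compl b) (compl a)) /\
  (ea_le a b -> ea_le (natimp b c) (natimp a c)).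
Proof.
split; first exact: natimp_eq1.
split=> [/compl_le|].
  (* From [b = b'' <= a'], (iii) applies to the pair [a'], [b]. *)
  by rewrite complK => /natimp_ge; rewrite complK.
split; first exact: natimp_ge.
split=> [ba|]; last exact: natimp_antil.
(* Applied to [a' <= b'], (iii) yields [b'' + a'], the same sum [a' + b] as for [b <= a]. *)
have := natimp_ge (compl_le ba); rewrite complK => /oplusC.
by rewrite (natimp_ge ba) => -[].
Qed.
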